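(* Let $Y$ be a random vector with density $f(y;\theta)$ on $\mathcal{Y}\subset\mathbb{R}^k$, $\theta\in\Theta$, let $G$ be a coarsening variable whose conditional distribution given $Y=y$ is $f(g\mid y;\psi)=h(g,y;\psi)$, $\psi\in\Psi$, with $\psi$ distinct from $\theta$, and let the observable outcome be the random measurable subset $Z=Z(Y,G)$ of the sample space $\mathcal{Y}$. If $\{f(y;\theta):\theta\in\Theta\}$ is a complete family, then a necessary and sufficient condition for the coarsening data mechanism $h(g,y;\psi)$ to be likelihood ignorable (LIG) is that it is coarsening at random (CAR).
   Context: Coarse data model: the coarsening function $Z(y,g)$ takes values in the measurable subsets of $\mathcal{Y}$, with $y\in Z(y,g)$; one observes only the set $z=Z(y,g)$. Distinct parameters: the joint parameter space of $(\theta,\psi)$ is the product $\Theta\times\Psi$. The conditional distribution $h(g,y;\psi)$ of $G$ given $Y=y$ is called the coarsening data mechanism (CDM). The conditional distribution of $Z$ given $Y=y$ is expressed as $$\kappa(z,y;\psi)=\int_{\{g\,:\,Z(y,g)=z\}}h(g,y;\psi)\,dg;$$ when $G$ is continuous, $\kappa(z,y;\psi)$ is understood as the conditional density of $Z$ given $Y=y$. For example, when $Y=(Y_1,Y_2)$, $Y_2$ is right censored at $g$ and $z=\{y_1\}\times(g,\infty)$, it is $h(g,y;\psi)$. The likelihood function for $\theta$ based on an observed $z$ is proportional to $\int_z f(y;\theta)\kappa(z,y;\psi)\,dy$. Integrals over a set $z$ are over the coordinates that are not determined by $z$ (e.g. over $y_2\in(g,\infty)$ when $z=\{y_1\}\times(g,\infty)$).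 Complete family: $\{f(y;\theta):\theta\in\Theta\}$ on $\mathcal{Y}$ is complete if the identity $\int t(y)f(y;\theta)\,dy=0$ for all $\theta\in\Theta$ implies that $t(y)=0$ for almost all $y\in\mathcal{Y}$. CAR: the CDM is CAR if, for any fixed observed subset $z$, and for each value of $\psi$, $\kappa(z,y;\psi)$ takes the same value for all $y\in z$. LIG: the CDM is LIG if, for an observed subset $z$, as functions of $\theta$, $$\int_z f(y;\theta)\,\kappa(z,y;\psi)\,dy\ \propto\ \int_z f(y;\theta)\,dy,$$ i.e. the two sides differ by a factor $w(z;\psi)$ not depending on $\theta$.
   Formalization: CAR is required for almost all y in z, and CAR and LIG for almost all observed z (with ''all'', LIG does not imply CAR: alter h at one y); reference measures for Z are assumed that make the integral of f κ over z, over the undetermined coordinates, the density of Z. *)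

(* Defs.v *)
From HB Require Import structures.
From mathcomp Require Import all_boot all_order all_algebra.
From mathcomp Require Import all_classical all_reals all_analysis.
From mathcomp Require Import measurable_realfun.
Set Implicit Arguments.
Unset Strict Implicit.
Unset Printing Implicit Defensive.
Import Order.TTheory GRing.Theory Num.Theory.
Import numFieldNormedType.Exports.
Local Open Scope classical_set_scope.
Local Open Scope ring_scope.
Local Open Scope ereal_scope.

(* Product of measures on [T], one for each coordinate, on [n.-tuple T]; see
   [tuple_measure_box]. *)
Section tuple_measure.
Context d (T : measurableType d) (R : realType).

Section step.
Context n (m : {sigma_finite_measure set T -> \bar R})
  (mu : {sigma_finite_measure set (n.-tuple T) -> \bar R}).

Definition cons_pair (p : T * n.-tuple T) : n.+1.-tuple T := [tuple of p.1 :: p.2].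

Lemma measurable_cons_pair : measurable_fun setT cons_pair.
Proof.
exact: (@measurable_cons _ _ _ _ fst n snd measurable_fst measurable_snd).
Qed.

Definition cons_measure : set (n.+1.-tuple T) -> \bar R :=
  pushforward (m \x mu) cons_pair.

Let cons_measure0 : cons_measure set0 = 0.
Proof. by rewrite /cons_measure /pushforward preimage_set0 measure0. Qed.

Let cons_measure_ge0 A : 0 <= cons_measure A.
Proof. by rewrite /cons_measure /pushforward. Qed.

Let cons_measure_sigma_additive : semi_sigma_additive cons_measure.
Proof.
move=> F mF tF mUF; rewrite /cons_measure /pushforward preimage_bigcup.
apply: measure_semi_sigma_additive.
- by move=> i; rewrite -[X in measurable X]setTI; exact: measurable_cons_pair.
- by apply/trivIsetP => /= i j _ _ ij; rewrite -preimage_setI;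
    move/trivIsetP : tF => ->//; rewrite preimage_set0.
- by rewrite -preimage_bigcup -[X in measurable X]setTI;
    exact: measurable_cons_pair.
Qed.

HB.instance Definition _ := isMeasure.Build _ _ _ cons_measure
  cons_measure0 cons_measure_ge0 cons_measure_sigma_additive.

Let cons_measure_sigma_finite : sigma_finite setT cons_measure.
Proof.
have [F FT Foo] : sigma_finite setT (m \x mu).
  have /sigma_finiteP[F [FT ndF Foo]] := sigma_finiteT m.
  have /sigma_finiteP[G [GT ndG Goo]] := sigma_finiteT mu.
  exists (fun n => F n `*` G n).
    rewrite -setXTT FT GT predeqE => -[x y]; split; last first.
      by move=> [i _ []/= ? ?]; split; exists i.
    move=> [/= [i _ Fix] [j _ Gjy]]; exists (maxn i j) => //; split.
    - by move: x Fix; exact/subsetPset/ndF/leq_maxl.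
    - by move: y Gjy; exact/subsetPset/ndG/leq_maxr.
  move=> i; have [mF Fioo] := Foo i; have [mG Gioo] := Goo i.
  split; first exact: measurableX.
  by rewrite product_measure1E// lte_mul_pinfty// ge0_fin_numE.
pose g (t : n.+1.-tuple T) : T * n.-tuple T := (thead t, [tuple of behead t]).
have mg : measurable_fun setT g.
  apply/measurable_fun_pairP; split; first exact: measurable_tnth.
  exact: measurable_behead.
have gK : cancel cons_pair g.
  by case=> x t; rewrite /g theadE; congr (_, _); exact/val_inj.
exists (fun i => g @^-1` F i).
  by rewrite -preimage_bigcup -FT preimage_setT.
move=> i; have [mFi Fioo] := Foo i; split.
  rewrite -[X in measurable X]setTI; exact: mg.
rewrite /cons_measure /pushforward /=.
rewrite (_ : _ @^-1` _ = F i)//; apply/funext => p /=.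
by rewrite /preimage/= gK.
Qed.

HB.instance Definition _ := @Measure_isSigmaFinite.Build _ _ _ cons_measure
  cons_measure_sigma_finite.

End step.

Fixpoint tuple_measure n :
    ('I_n -> {sigma_finite_measure set T -> \bar R}) ->
    {sigma_finite_measure set (n.-tuple T) -> \bar R} :=
  match n with
  | 0 => fun _ => (\d_([tuple] : 0.-tuple T) : {sigma_finite_measure set _ -> \bar R})
  | n'.+1 => fun m => (cons_measure (m ord0)
        (tuple_measure (fun i : 'I_n' => m (lift ord0 i)))
        : {sigma_finite_measure set _ -> \bar R})
  end.

Lemma tuple_measure_box n (m : 'I_n -> {sigma_finite_measure set T -> \bar R})
    (A : 'I_n -> set T) : (forall i, measurable (A i)) ->
  tuple_measure m [set t | forall i, A i (tnth t i)] = \prod_(i < n) m i (A i).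
Proof.
elim: n m A => [|n IH] m A mA /=.
  by rewrite big_ord0 diracE mem_set// => -[].
rewrite big_ord_recl /cons_measure /pushforward.
rewrite (_ : _ @^-1` _ =
    A ord0 `*` [set t : n.-tuple T | forall i, A (lift ord0 i) (tnth t i)]).
  rewrite product_measure1E//; last first.
    rewrite [X in measurable X](_ : _ = \bigcap_(i in [set: 'I_n])
      ((fun t : n.-tuple T => tnth t i) @^-1` A (lift ord0 i))).
      apply: fin_bigcap_measurable; first exact: finite_finset.
      by move=> i _; rewrite -[X in measurable X]setTI; exact: measurable_tnth.
    by apply/seteqP; split=> t /= h i; [move=> _; exact: h|exact: h].
  by congr *%E; exact: IH.
apply/seteqP; split=> -[x t] /=.
  move=> h; split; first by have := h ord0; rewrite tnth0.
  by move=> i; have := h (lift ord0 i); rewrite tnthS.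
move=> -[/= h0 h] i; case: (unliftP ord0 i) => [j|] ->.
  by rewrite tnthS.
by rewrite tnth0.
Qed.

End tuple_measure.

Definition density_on d (T : measurableType d) (R : realType)
    (mu : {measure set T -> \bar R}) (D : set T) (p : T -> R) : Prop :=
  [/\ measurable_fun D p,
      (forall x, D x -> (0 <= p x)%R) &
      \int[mu]_(x in D) (p x)%:E = 1].

(* [R^k]; [measurableTypeR R] is [R] with the display of [lebesgue_measure]. *)
Notation realvec R k := (k.-tuple (measurableTypeR R)).

Section coarse_data.
Context (R : realType) (k : nat).
Implicit Types (y : realvec R k) (A : set (realvec R k)).

Definition lebesgue_tuple : {sigma_finite_measure set (realvec R k) -> \bar R} :=
  tuple_measure (fun _ : 'I_k =>
    (@lebesgue_measure R : {sigma_finite_measure set (measurableTypeR R) -> \bar R})).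

(* "[A] determines the [i]-th coordinate": it is constant on [A]. *)
Definition coord_value A (i : 'I_k) : set R :=
  [set c | forall y, A y -> tnth y i = c].

(* The integral over a set [A] is over the coordinates that are not determined
   by [A]: such coordinates carry Lebesgue measure, whereas a determined one is
   set to its value, i.e. carries the Dirac measure at this value. The measure
   itself is not restricted to [A]; one writes
   [\int[free_lebesgue A]_(y in A) _]. *)
Definition free_lebesgue A : {sigma_finite_measure set (realvec R k) -> \bar R} :=
  tuple_measure (fun i : 'I_k =>
    if `[< coord_value A i !=set0 >]
    then (\d_(xget 0%R (coord_value A i) : measurableTypeR R)
          : {sigma_finite_measure set (measurableTypeR R) -> \bar R})
    else (@lebesgue_measure R : {sigma_finite_measure set (measurableTypeR R) -> \bar R})).

Definition complete_family (Theta : Type) (Y : set (realvec R k))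
    (f : realvec R k -> Theta -> R) : Prop :=
  forall t : realvec R k -> R, measurable_fun Y t ->
  (forall theta,
     lebesgue_tuple.-integrable Y (fun y => (t y * f y theta)%:E)) ->
  (forall theta, \int[lebesgue_tuple]_(y in Y) (t y * f y theta)%:E = 0) ->
  {ae lebesgue_tuple, forall y, Y y -> t y = 0%R}.

Context (dG dZ : measure_display) (TG : measurableType dG)
  (TZ : measurableType dZ).

(* The observable subsets of [Y] form a measurable space [TZ]: a point [z] of
   [TZ] stands for the subset [elts z], and distinct points for distinct
   subsets. *)
Definition is_coarsening (Y : set (realvec R k)) (elts : TZ -> set (realvec R k))
    (Z : realvec R k -> TG -> TZ) : Prop :=
  [/\ injective elts,
      (forall z, elts z `<=` Y),
      measurable [set p : realvec R k * TZ | elts p.2 p.1],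
      measurable_fun (Y `*` [set: TG])
        (fun p : realvec R k * TG => Z p.1 p.2) &
      (forall y g, Y y -> elts (Z y g) y)].

Definition is_cdm (Y : set (realvec R k)) (dg : {measure set TG -> \bar R})
    (h : TG -> realvec R k -> R) : Prop :=
  measurable_fun ([set: TG] `*` Y) (fun p : TG * realvec R k => h p.1 p.2) /\
  forall y, Y y -> density_on dg [set: TG] (h^~ y).

(* [tau y] is the reference measure for the conditional density of the observed
   set given [y], [rho] the one for its marginal density. They fit together
   with the integrals over the sets [z] if
     tau_y(dz) dy = d_z y rho(dz)   on {(y, z) | y in z},
   which is what makes \int_z f(y; theta) kappa(z, y; psi) dy the density of the
   observed set, i.e. the likelihood of theta. Examples:
   - if there are countably many observable sets, none of them with a
     determined coordinate, [tau y] and [rho] are the counting measure;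
   - if y_2 is right censored at g, [rho] is dy_1 dg on the sets
     {y_1} x (g, oo) and dy_1 dy_2 on the sets {(y_1, y_2)}; [tau y] is dg on
     the sets {y_1} x (g, oo), g < y_2, plus a unit mass at {(y_1, y_2)}. *)
Definition compatible_reference (Y : set (realvec R k))
    (elts : TZ -> set (realvec R k)) (tau : R.-sfker realvec R k ~> TZ)
    (rho : {sigma_finite_measure set TZ -> \bar R}) : Prop :=
  (exists K : R.-sfker TZ ~> realvec R k,
     forall z A, measurable A -> K z A = free_lebesgue (elts z) A) /\
  forall phi : realvec R k * TZ -> \bar R,
    measurable_fun setT phi -> (forall p, 0 <= phi p) ->
    \int[lebesgue_tuple]_(y in Y)
      \int[tau y]_(z in [set z | elts z y]) phi (y, z) =
    \int[rho]_z \int[free_lebesgue (elts z)]_(y in elts z) phi (y, z).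

(* [kappa] is the density with respect to [tau y] of the conditional
   distribution of the observed set given [y]; at an atom of [tau y] it is given
   by the integral of [h] over {g | Z(y, g) = z}, see [coarsening_density_atom]. *)
Definition is_coarsening_density (Y : set (realvec R k))
    (dg : {measure set TG -> \bar R}) (elts : TZ -> set (realvec R k))
    (Z : realvec R k -> TG -> TZ) (tau : R.-sfker realvec R k ~> TZ)
    (h : TG -> realvec R k -> R) (kappa : TZ -> realvec R k -> R) : Prop :=
  [/\ measurable_fun [set p : realvec R k * TZ | elts p.2 p.1]
        (fun p : realvec R k * TZ => kappa p.2 p.1),
      (forall z y, elts z y -> (0 <= kappa z y)%R) &
      forall y, Y y -> forall B : set TZ, measurable B ->
        \int[dg]_(g in [set g | B (Z y g)]) (h g y)%:E =
        \int[tau y]_(z in B `&` [set z | elts z y]) (kappa z y)%:E].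

Lemma coarsening_density_atom (Y : set (realvec R k))
    (dg : {measure set TG -> \bar R}) (elts : TZ -> set (realvec R k))
    (Z : realvec R k -> TG -> TZ) (tau : R.-sfker realvec R k ~> TZ)
    (h : TG -> realvec R k -> R) (kappa : TZ -> realvec R k -> R) y z :
  is_coarsening_density Y dg elts Z tau h kappa ->
  Y y -> elts z y -> measurable [set z] -> tau y [set z] = 1 ->
  (kappa z y)%:E = \int[dg]_(g in [set g | Z y g = z]) (h g y)%:E.
Proof.
move=> [_ _ dens] Yy zy mz tauz.
rewrite (dens y Yy [set z] mz) setIidl; last by move=> _ ->.
rewrite (eq_integral (cst (kappa z y)%:E)) => [|_ /set_mem -> //].
by rewrite integral_cst// tauz mule1.
Qed.

(* Conditional densities, and the functions that a complete family determines,
   are defined up to null sets only. Hence "for all y in z" means for almost all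
   [y] in [z], and "for any observed z" for [rho]-almost all [z]. *)
Definition CAR (Psi : Type) (elts : TZ -> set (realvec R k))
    (rho : {sigma_finite_measure set TZ -> \bar R})
    (kappa : TZ -> realvec R k -> Psi -> R) : Prop :=
  forall psi, {ae rho, forall z, exists c : R,
    {ae free_lebesgue (elts z), forall y, elts z y -> kappa z y psi = c}}.

Definition LIG (Theta Psi : Type) (elts : TZ -> set (realvec R k))
    (rho : {sigma_finite_measure set TZ -> \bar R})
    (f : realvec R k -> Theta -> R) (kappa : TZ -> realvec R k -> Psi -> R)
    : Prop :=
  forall psi, {ae rho, forall z, exists w : R, forall theta,
    \int[free_lebesgue (elts z)]_(y in elts z) (f y theta * kappa z y psi)%:E =
    w%:E * \int[free_lebesgue (elts z)]_(y in elts z) (f y theta)%:E}.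

End coarse_data.

(* Main.v *)
(* That CAR implies LIG is immediate, with w(z; psi) the common value of kappa.

   Conversely, fix psi. LIG says that, for rho-almost every z and all theta,
     \int_z f(y; theta) kappa(z, y) dy = w(z) \int_z f(y; theta) dy,
   where w may be taken measurable in z: it is a supremum of quotients over a
   sequence of thetas that is essentially as good as Theta. Integrate this over
   the z in a measurable set B and exchange the integrals by means of
   tau_y(dz) dy = d_z y rho(dz). Completeness, applied to a function of y alone,
   gives, for almost every y,
     \int_B kappa(z, y) 1_{y in z} tau_y(dz) = \int_B w(z) 1_{y in z} tau_y(dz).
   The exceptional set depends on B, and the sigma-algebra of the observable sets
   need not be countably generated; but after multiplication by the probability
   density f(y; theta), the two sides define finite measures in (y, z) which
   agree on rectangles, hence everywhere. So f(y; theta) |kappa(z, y) - w(z)|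
   vanishes almost everywhere for each theta, and a second use of completeness
   removes the factor f(y; theta). Going back to rho, kappa(z, .) = w(z) almost
   everywhere on z, for rho-almost every z. *)
Require Import Defs.
From mathcomp Require Import all_boot all_order all_algebra.
From mathcomp Require Import all_classical all_reals all_analysis.
From mathcomp Require Import measurable_realfun.
Import Order.TTheory GRing.Theory Num.Theory.
Local Open Scope classical_set_scope.
Local Open Scope ring_scope.
Local Open Scope ereal_scope.

(** * Null integrals and cancellation *)

Lemma ae_eq0_integral d (X : measurableType d) (R : realType)
    (mu : {measure set X -> \bar R}) (f : X -> \bar R) :
  measurable_fun setT f -> (forall x, 0 <= f x) -> \int[mu]_x f x = 0 ->
  {ae mu, forall x, f x = 0}.
Proof.
move=> mf f0 If.
have /(ae_eq_integral_abs _ measurableT mf) h : \int[mu]_x `|f x| = 0.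
  by rewrite -If; apply: eq_integral => x _; rewrite gee0_abs.
by apply: filterS h => x; exact.
Qed.

Lemma adde_fin_inj (R : numDomainType) (x x' y z : \bar R) : x \is a fin_num ->
  x = x' -> x + y = x' + z -> y = z.
Proof.
by move=> xfin <- /(congr1 (fun r => r - x)); rewrite !(addeC x) !addeK.
Qed.

(** * Iterated integrals against a kernel, and uniqueness of densities *)

Section iterated_integral.
Context d d' (X : measurableType d) (T : measurableType d') (R : realType).
Variables (mu : {measure set X -> \bar R}) (tau : R.-sfker X ~> T).
Implicit Types (u v w : X * T -> R) (A S : set (X * T)) (g h : X * T -> \bar R).

Lemma measurable_iterated g : measurable_fun setT g -> (forall p, 0 <= g p) ->
  measurable_fun setT (fun x => \int[tau x]_z g (x, z)).
Proof. by move=> mg g0; exact: measurable_fun_integral_sfinite_kernel. Qed.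

Lemma iterated_integralD g h : measurable_fun setT g -> (forall p, 0 <= g p) ->
  measurable_fun setT h -> (forall p, 0 <= h p) ->
  \int[mu]_x \int[tau x]_z (g (x, z) + h (x, z)) =
  \int[mu]_x \int[tau x]_z g (x, z) + \int[mu]_x \int[tau x]_z h (x, z).
Proof.
move=> mg g0 mh h0; rewrite -ge0_integralD//; last 4 first.
- by move=> x _; exact: integral_ge0.
- exact: measurable_iterated.
- by move=> x _; exact: integral_ge0.
- exact: measurable_iterated.
apply: eq_integral => x _; rewrite ge0_integralD//.
- exact: measurableT_comp.
- exact: measurableT_comp.
Qed.

Lemma iterated_integral_nneseries (g : (X * T -> \bar R)^nat) :
  (forall n, measurable_fun setT (g n)) -> (forall n p, 0 <= g n p) ->
  \int[mu]_x \int[tau x]_z \sum_(n <oo) g n (x, z) =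
  \sum_(n <oo) \int[mu]_x \int[tau x]_z g n (x, z).
Proof.
move=> mg g0; rewrite -integral_nneseries//.
- apply: eq_integral => x _; rewrite integral_nneseries// => n.
  exact: measurableT_comp.
- by move=> n; exact: measurable_iterated.
- by move=> n x _; exact: integral_ge0.
Qed.

Section uniqueness.
Variables (u v : X * T -> R).
Hypotheses (mfu : measurable_fun setT u) (mfv : measurable_fun setT v).
Hypotheses (u0 : forall p, (0 <= u p)%R) (v0 : forall p, (0 <= v p)%R).
Hypothesis uoo : \int[mu]_x \int[tau x]_z (u (x, z))%:E < +oo.
Hypothesis uv : forall B, measurable B ->
  {ae mu, forall x, \int[tau x]_z (u (x, z) * \1_B z)%:E =
                    \int[tau x]_z (v (x, z) * \1_B z)%:E}.

Let m1 w A : measurable_fun setT w -> measurable A ->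
  measurable_fun setT (fun p => (w p * \1_A p)%:E).
Proof. by move=> mw mA; apply/measurable_EFinP; exact: measurable_funM. Qed.

Let p1 w A p : (forall p, (0 <= w p)%R) -> 0 <= (w p * \1_A p)%:E.
Proof. by move=> w0; rewrite lee_fin mulr_ge0// indicE. Qed.

(** Both sides are finite measures in [S]. They agree on rectangles, which are stable under
    intersection and generate the product sigma-algebra, so Dynkin induction applies. *)
Lemma iterated_integral_eq S : measurable S ->
  \int[mu]_x \int[tau x]_z (u (x, z) * \1_S (x, z))%:E =
  \int[mu]_x \int[tau x]_z (v (x, z) * \1_S (x, z))%:E.
Proof.
have rect (A : set X) (B : set T) : measurable A -> measurable B ->
    \int[mu]_x \int[tau x]_z (u (x, z) * \1_(A `*` B) (x, z))%:E =
    \int[mu]_x \int[tau x]_z (v (x, z) * \1_(A `*` B) (x, z))%:E.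
  move=> mA mB; have mAB := measurableX mA mB.
  (* The null set of [uv] depends on [B], but [B] is fixed here, so integrating over [x] absorbs
     it. *)
  apply: ge0_ae_eq_integral => //.
  - exact: (@measurable_iterated _ (m1 u _ mfu mAB) (fun p => p1 u _ p u0)).
  - exact: (@measurable_iterated _ (m1 v _ mfv mAB) (fun p => p1 v _ p v0)).
  - by move=> x _; apply: integral_ge0 => z _; exact: p1.
  - by move=> x _; apply: integral_ge0 => z _; exact: p1.
  have := uv _ mB; apply: filterS => x uvx _.
  have [xA|xA] := boolP (x \in A).
    have e z : \1_(A `*` B) (x, z) = \1_B z :> R.
      by rewrite !indicE in_setX/= xA.
    by under eq_integral do rewrite e; rewrite uvx;
       under [RHS]eq_integral do rewrite e.
  have e z : \1_(A `*` B) (x, z) = 0%R :> R.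
    by rewrite !indicE in_setX/= (negbTE xA).
  by under eq_integral do rewrite e mulr0;
     under [RHS]eq_integral do rewrite e mulr0.
have eT : \int[mu]_x \int[tau x]_z (u (x, z))%:E =
          \int[mu]_x \int[tau x]_z (v (x, z))%:E.
  have := rect _ _ measurableT measurableT.
  have e (w : X * T -> R) p : (w p * \1_(setT `*` setT) p)%R = w p.
    by rewrite setXTT indicE in_setT mulr1.
  under eq_integral do under eq_integral do rewrite e.
  by under [in RHS]eq_integral do under eq_integral do rewrite e.
move: S.
suff : forall S, <<s [set A `*` B | A in measurable & B in measurable] >> S ->
  \int[mu]_x \int[tau x]_z (u (x, z) * \1_S (x, z))%:E =
  \int[mu]_x \int[tau x]_z (v (x, z) * \1_S (x, z))%:E.
  by move=> h S; rewrite measurable_prod_measurableType => /h.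
apply: dynkin_induction => /=.
- by rewrite measurable_prod_measurableType.
- move=> _ _ [A1 mA1 [A2 mA2 <-]] [B1 mB1 [B2 mB2 <-]].
  exists (A1 `&` B1); first exact: measurableI.
  exists (A2 `&` B2); first exact: measurableI.
  by rewrite setXI.
- by rewrite -setXTT; exact: rect.
- by move=> _ [A mA [B mB <-]]; exact: rect.
- move=> S mS IS; have mCS := measurableC mS.
  have split (w : X * T -> R) : measurable_fun setT w -> (forall p, (0 <= w p)%R) ->
    \int[mu]_x \int[tau x]_z (w (x, z))%:E =
    \int[mu]_x \int[tau x]_z (w (x, z) * \1_S (x, z))%:E +
    \int[mu]_x \int[tau x]_z (w (x, z) * \1_(~` S) (x, z))%:E.
    move=> mw w0.
    rewrite -(@iterated_integralD _ _ (m1 w S mw mS) (fun p => p1 w S p w0)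
       (m1 w (~` S) mw mCS) (fun p => p1 w (~` S) p w0)).
    apply: eq_integral => x _; apply: eq_integral => z _.
    rewrite -EFinD -mulrDr !indicE in_setC.
    by case: (_ \in S); rewrite ?addr0 ?add0r mulr1.
  have Su := split u mfu u0; have Sv := split v mfv v0.
  (* The mass of [S] has to be finite to be cancelled from the two equal total masses [eT]. *)
  have Soo : \int[mu]_x \int[tau x]_z (u (x, z) * \1_S (x, z))%:E \is a fin_num.
    rewrite ge0_fin_numE; last first.
      by apply: integral_ge0 => x _; apply: integral_ge0 => z _; exact: p1.
    apply: le_lt_trans uoo; rewrite Su; apply: leeDl.
    by apply: integral_ge0 => x _; apply: integral_ge0 => z _; exact: p1.
  by apply: (adde_fin_inj _ _ _ _ _ Soo IS); rewrite -Su -Sv.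
- move=> F mF tF IF.
  have E (w : X * T -> R) : measurable_fun setT w -> (forall p, (0 <= w p)%R) ->
    \int[mu]_x \int[tau x]_z (w (x, z) * \1_(\bigcup_k F k) (x, z))%:E =
    \sum_(k <oo) \int[mu]_x \int[tau x]_z (w (x, z) * \1_(F k) (x, z))%:E.
    move=> mw w0.
    rewrite -(@iterated_integral_nneseries (fun k p => (w p * \1_(F k) p)%:E)).
    - apply: eq_integral => x _; apply: eq_integral => z _.
      under eq_eseriesr do rewrite EFinM.
      rewrite nneseriesZl//.
      by rewrite EFinM indic_bigcup.
    - by move=> n; exact: m1.
    - by move=> n p; exact: p1.
  by rewrite (E u mfu u0) (E v mfv v0); apply: eq_eseriesr => k _; exact: IF.
Qed.

(** Split the space along the set where [v < u]. On each half the distance is the larger function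
    minus the smaller one, and the two have the same integral there by [iterated_integral_eq]. *)
Lemma iterated_integral_dist_eq0 :
  \int[mu]_x \int[tau x]_z `|u (x, z) - v (x, z)|%:E = 0.
Proof.
pose D p := `|u p - v p|%R.
have mD : measurable_fun setT D.
  by apply: measurableT_comp => //; exact: measurable_funB.
have D0 p : (0 <= D p)%R by exact: normr_ge0.
have uSoo S : measurable S ->
    \int[mu]_x \int[tau x]_z (u (x, z) * \1_S (x, z))%:E \is a fin_num.
  move=> mS; rewrite ge0_fin_numE; last first.
    by apply: integral_ge0 => x _; apply: integral_ge0 => z _; exact: p1.
  apply: le_lt_trans uoo; apply: ge0_le_integral => //.
  - by move=> x _; apply: integral_ge0 => z _; exact: p1.
  - exact: (@measurable_iterated _ (m1 u S mfu mS) (fun p => p1 u S p u0)).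
  - by apply: (@measurable_iterated (EFin \o u)) => [|p];
      [exact/measurable_EFinP|rewrite lee_fin].
  - move=> x _; apply: ge0_le_integral => //.
    + by move=> z _; exact: p1.
    + exact: (measurableT_comp (m1 u S mfu mS)).
    + by apply/measurable_EFinP; apply: measurableT_comp.
    + by move=> z _; rewrite lee_fin ler_piMr// indicE; case: (_ \in _).
(* If [w1] exceeds [w2] by exactly [D] on [S] and both have the same finite integral over [S], then
   [D] integrates to 0 there. *)
have gap S (w1 w2 : X * T -> R) : measurable S ->
    measurable_fun setT w2 -> (forall p, (0 <= w2 p)%R) ->
    (forall p, S p -> w1 p = w2 p + D p)%R ->
    \int[mu]_x \int[tau x]_z (w1 (x, z) * \1_S (x, z))%:E =
    \int[mu]_x \int[tau x]_z (w2 (x, z) * \1_S (x, z))%:E ->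
    \int[mu]_x \int[tau x]_z (w2 (x, z) * \1_S (x, z))%:E \is a fin_num ->
    \int[mu]_x \int[tau x]_z (D (x, z) * \1_S (x, z))%:E = 0.
  move=> mS mw2 w20 Sw w12 w2oo; apply: (adde_fin_inj _ _ _ _ _ w2oo erefl).
  rewrite adde0 -[RHS]w12.
  rewrite -(@iterated_integralD _ _ (m1 w2 S mw2 mS) (fun p => p1 w2 S p w20)
     (m1 D S mD mS) (fun p => p1 D S p D0)).
  apply: eq_integral => x _; apply: eq_integral => z _.
  rewrite -EFinD -mulrDl !indicE; have [/set_mem/Sw->//|_] := boolP (_ \in S).
  by rewrite !mulr0.
pose A := [set p | (v p < u p)%R].
have mA : measurable A.
  by rewrite -[A]setTI; exact: (measurable_fun_ltr mfv mfu).
have mCA := measurableC mA.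
transitivity (\int[mu]_x \int[tau x]_z (D (x, z) * \1_A (x, z))%:E +
              \int[mu]_x \int[tau x]_z (D (x, z) * \1_(~` A) (x, z))%:E).
  rewrite -(@iterated_integralD _ _ (m1 D A mD mA) (fun p => p1 D A p D0)
     (m1 D _ mD mCA) (fun p => p1 D _ p D0)).
  apply: eq_integral => x _; apply: eq_integral => z _.
  rewrite -EFinD -mulrDr !indicE in_setC.
  by case: (_ \in A); rewrite ?addr0 ?add0r mulr1.
rewrite (gap A u v)//; last 3 first.
- by move=> p /= vu; rewrite /D gtr0_norm ?subr_gt0// addrC subrK.
- exact: iterated_integral_eq.
- by rewrite -iterated_integral_eq//; exact: uSoo.
rewrite (gap (~` A) v u) ?adde0//; last 2 first.
- by rewrite iterated_integral_eq.
- exact: uSoo.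
move=> p /= /negP; rewrite -leNgt => uv'.
by rewrite /D ler0_norm ?subr_le0// opprB addrC subrK.
Qed.

End uniqueness.
End iterated_integral.

(** * Completeness for functions with extended real values *)

Lemma mule_fineK (R : realDomainType) (r : R) (a : \bar R) : (0 <= r)%R -> 0 <= a ->
  r%:E * a \is a fin_num -> (r * fine a)%:E = r%:E * a.
Proof.
(* Only [a = +oo] remains: a finite product then forces [r = 0], and both sides vanish. *)
case: a => [a||]// r0 _; move: r0; rewrite le_eqVlt => /orP[/eqP <-|r0].
  by rewrite mul0r mul0e.
by rewrite gt0_muley ?lte_fin.
Qed.

Section complete.
Context d (X : measurableType d) (R : realType) (mu : {measure set X -> \bar R}).
Context (Theta : Type) (Y : set X) (f : Theta -> X -> R).
Hypotheses (mf : forall theta, measurable_fun setT (f theta)).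
Hypotheses (f0 : forall theta x, (0 <= f theta x)%R).
Hypothesis complete : forall t : X -> R, measurable_fun setT t ->
  (forall theta, mu.-integrable setT (fun x => (t x * f theta x)%:E)) ->
  (forall theta, \int[mu]_x (t x * f theta x)%:E = 0) ->
  {ae mu, forall x, Y x -> t x = 0%R}.

Let integrable_mul (c : X -> \bar R) theta : measurable_fun setT c ->
  (forall x, 0 <= c x) -> \int[mu]_x ((f theta x)%:E * c x) < +oo ->
  mu.-integrable setT (fun x => (f theta x)%:E * c x).
Proof.
move=> mc c0 fcoo; apply/integrableP; split.
  by apply: emeasurable_funM => //; exact/measurable_EFinP.
rewrite (eq_integral (fun x => (f theta x)%:E * c x))// => x _.
by rewrite gee0_abs// mule_ge0// lee_fin.
Qed.

Let ae_fine (c : X -> \bar R) theta : measurable_fun setT c ->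
  (forall x, 0 <= c x) -> \int[mu]_x ((f theta x)%:E * c x) < +oo ->
  {ae mu, forall x, (f theta x * fine (c x))%:E = (f theta x)%:E * c x}.
Proof.
move=> mc c0 fcoo; have := integrable_ae measurableT (integrable_mul _ _ mc c0 fcoo).
by apply: filterS => x /(_ I); exact: mule_fineK.
Qed.

(** Completeness is tested on the indicator of the set where [c] is infinite. Finiteness of the
    integrals makes every [f theta] vanish almost everywhere on that set. *)
Lemma complete_ae_lty (c : X -> \bar R) : measurable_fun setT c ->
  (forall x, 0 <= c x) ->
  (forall theta, \int[mu]_x ((f theta x)%:E * c x) < +oo) ->
  {ae mu, forall x, Y x -> c x < +oo}.
Proof.
move=> mc c0 fcoo; pose A := [set x | c x = +oo].
have mA : measurable A by rewrite -[A]setTI; exact: emeasurable_fun_eq.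
have m1 : measurable_fun setT (\1_A : X -> R) by exact: measurable_indic.
have mt theta : measurable_fun setT (fun x => (\1_A x * f theta x)%:E).
  by apply/measurable_EFinP; exact: measurable_funM.
have ae0 theta : {ae mu, forall x, (\1_A x * f theta x)%:E = 0 :> \bar R}.
  have := integrable_ae measurableT (integrable_mul _ _ mc c0 (fcoo theta)).
  apply: filterS => x /(_ I); rewrite indicE.
  have [/set_mem/= ->|_ _] := boolP (x \in A); last by rewrite mul0r.
  have := f0 theta x; rewrite le_eqVlt => /orP[/eqP <-|fx].
    by rewrite mulr0.
  by rewrite gt0_muley ?lte_fin.
have int0 theta : \int[mu]_x (\1_A x * f theta x)%:E = 0.
  rewrite -(integral0 mu setT); apply: ae_eq_integral => //.
  by apply: filterS (ae0 theta).
have := @complete \1_A m1 _ int0; have h : forall theta,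
    mu.-integrable setT (fun x => (\1_A x * f theta x)%:E).
  move=> theta; apply/integrableP; split => //.
  rewrite (eq_integral (fun x => (\1_A x * f theta x)%:E)) ?int0// => x _.
  by rewrite gee0_abs// lee_fin mulr_ge0// indicE.
move=> /(_ h); apply: filterS => x + Yx => /(_ Yx).
rewrite indicE; have [_ /eqP|xA _] := boolP (x \in A); first by rewrite oner_eq0.
by rewrite ltey; apply: contraNN xA => /eqP ?; exact/mem_set.
Qed.

(** Completeness concerns real functions, so it is applied to the difference of the finite parts; by
    [complete_ae_lty] these determine [a] and [b] almost everywhere on [Y]. *)
Lemma complete_ae_eq (a b : X -> \bar R) :
  measurable_fun setT a -> (forall x, 0 <= a x) ->
  measurable_fun setT b -> (forall x, 0 <= b x) ->
  (forall theta, \int[mu]_x ((f theta x)%:E * a x) < +oo) ->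
  (forall theta, \int[mu]_x ((f theta x)%:E * a x) =
                 \int[mu]_x ((f theta x)%:E * b x)) ->
  {ae mu, forall x, Y x -> a x = b x}.
Proof.
move=> ma a0 mb b0 aoo ab.
have boo theta : \int[mu]_x ((f theta x)%:E * b x) < +oo by rewrite -ab.
have mfine (c : X -> \bar R) : measurable_fun setT c -> measurable_fun setT (fine \o c).
  by move=> mc; exact: (measurableT_comp (fine_measurable _)).
have intE (c : X -> \bar R) theta : measurable_fun setT c -> (forall x, 0 <= c x) ->
    \int[mu]_x ((f theta x)%:E * c x) < +oo ->
    \int[mu]_x (f theta x * fine (c x))%:E = \int[mu]_x ((f theta x)%:E * c x) /\
    mu.-integrable setT (EFin \o (fun x => f theta x * fine (c x))%R).
  move=> mc c0 fcoo; have m1 : measurable_fun setT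
      (fun x => (f theta x * fine (c x))%:E).
    by apply/measurable_EFinP; apply: measurable_funM => //; exact: mfine.
  have e : \int[mu]_x (f theta x * fine (c x))%:E =
      \int[mu]_x ((f theta x)%:E * c x).
    apply: ae_eq_integral => //.
    - by apply: emeasurable_funM => //; exact/measurable_EFinP.
    - by apply: filterS (ae_fine _ _ mc c0 fcoo).
  split => //; apply/integrableP; split => //.
  rewrite (eq_integral (fun x => (f theta x * fine (c x))%:E)) ?e// => x _.
  by rewrite gee0_abs// lee_fin mulr_ge0// fine_ge0.
pose t x := (fine (a x) - fine (b x))%R.
have tE theta : (fun x => (t x * f theta x)%:E) = (fun x =>
    (f theta x * fine (a x))%:E - (f theta x * fine (b x))%:E).
  by apply/funext => x; rewrite -EFinB mulrC mulrBr.
have tae : {ae mu, forall x, Y x -> t x = 0%R}.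
  apply: complete => [|theta|theta].
  - by apply: measurable_funB; exact: mfine.
  - rewrite tE; apply: (@integrableB _ _ _ _ _ measurableT (EFin \o _) (EFin \o _)).
      exact: (intE _ _ ma a0 (aoo theta)).2.
    exact: (intE _ _ mb b0 (boo theta)).2.
  - have [ea ia] := intE _ _ ma a0 (aoo theta).
    have [eb ib] := intE _ _ mb b0 (boo theta).
    rewrite tE (integralB_EFin measurableT ia ib) ea eb -ab subee//.
    by rewrite ge0_fin_numE//; apply: integral_ge0 => x _; rewrite mule_ge0// lee_fin.
apply: filterS3 tae (complete_ae_lty _ ma a0 aoo) (complete_ae_lty _ mb b0 boo).
move=> x tx ax bx Yx; have /eqP := tx Yx; rewrite subr_eq0 => /eqP ab'.
by rewrite -[a x]fineK ?ge0_fin_numE ?ax// -[b x]fineK ?ge0_fin_numE ?bx// ab'.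
Qed.
End complete.

(** * Countable subfamilies that are essentially as large as the whole family *)

Lemma merge_seq (I : Type) (i0 : I) (s : nat -> nat -> I) :
  exists t : nat -> I, forall j m, exists n, t n = s j m.
Proof.
exists (fun n => if unpickle n is Some (j, m) then s j m else i0) => j m.
by exists (pickle (j, m)); rewrite pickleK.
Qed.

(** Exhaustion: among the countable unions of sets [S i], one has maximal mass within [F]. Adjoining
    a further [S i] cannot increase this mass, and as it is finite, the part added is null. *)
Lemma finite_ess_cover d (T : measurableType d) (R : realType)
    (rho : {measure set T -> \bar R}) (I : Type) (i0 : I) (S : I -> set T) (F : set T) :
  measurable F -> rho F < +oo -> (forall i, measurable (S i)) ->
  exists s : nat -> I,
    forall i, rho (F `&` (S i `\` \bigcup_n S (s n))) = 0.
Proof.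
move=> mF Foo mS.
pose U (s : nat -> I) := \bigcup_n S (s n).
have mU s : measurable (U s) by exact: bigcup_measurable.
pose V := [set rho (F `&` U s) | s in [set: nat -> I]].
have [u Vu u_sup] : {u : nat -> \bar R | forall i, V (u i) & u @ \oo --> ereal_sup V}.
  by apply: ereal_sup_seq; apply/set0P; exists (rho (F `&` U (fun=> i0))), (fun=> i0).
have [s su] : {s : nat -> nat -> I & forall j, rho (F `&` U (s j)) = u j}.
  apply: (@boolp.choice _ _ (fun j sj => rho (F `&` U sj) = u j)) => j.
  by have [sj _ <-] := Vu j; exists sj.
have [t tE] := merge_seq _ i0 s.
(* [t] runs through all the sequences [s j], whose masses tend to the supremum; hence [t] attains
   it. *)
have tsup : ereal_sup V <= rho (F `&` U t).
  have cu : cvgn u by apply/cvg_ex; exists (ereal_sup V).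
  rewrite -(cvg_lim _ u_sup)//; apply: lime_le => //.
  apply: nearW => j; rewrite -su le_measure ?inE//; [exact: measurableI..|].
  apply: setIS => z [m _ Sz]; have [n tn] := tE j m.
  by exists n => //; rewrite tn.
exists t => i; have mSi := mS i.
(* [i] is put in front of [t], which gives another competitor for the supremum. *)
pose t' n := if n is n'.+1 then t n' else i.
have Ut' : F `&` U t' = (F `&` U t) `|` (F `&` (S i `\` U t)).
  rewrite -setIUr; congr (_ `&` _); apply/seteqP; split => [z [[|n] _ Sz]|z].
  - by have [Uz|Uz] := pselect (U t z); [left|right].
  - by left; exists n.
  - by case=> [[n _ Sz]|[Sz _]]; [exists n.+1|exists 0%N].
have Uoo : rho (F `&` U t) \is a fin_num.
  rewrite ge0_fin_numE//; apply: le_lt_trans Foo.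
  by rewrite le_measure ?inE//; exact: measurableI.
have : rho (F `&` U t') <= rho (F `&` U t).
  by apply: le_trans tsup; apply: ereal_sup_ubound; exists t'.
rewrite Ut' measureU//; last 3 first.
- exact: measurableI.
- by apply: measurableI => //; exact: measurableD.
- by apply/seteqP; split => // z [[_ Uz] [_ []]].
rewrite -[leRHS]adde0 leeD2lE// => h.
by apply/eqP; rewrite eq_le h measure_ge0.
Qed.

(** Apply [finite_ess_cover] to each piece of finite measure and merge the sequences. For an index
    type without any structure, the result takes the place of a countable dense subset. *)
Lemma ess_cover d (T : measurableType d) (R : realType)
    (rho : {sigma_finite_measure set T -> \bar R}) (I : Type) (i0 : I)
    (S : I -> set T) :
  (forall i, measurable (S i)) ->
  exists s : nat -> I,
    forall i, {ae rho, forall z, S i z -> exists n, S (s n) z}.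
Proof.
move=> mS; have [F FT Foo] := sigma_finiteT rho.
have [s sE] : {s : nat -> nat -> I & forall k i,
    rho (F k `&` (S i `\` \bigcup_n S (s k n))) = 0}.
  apply: (@boolp.choice _ _ (fun k sk => forall i,
    rho (F k `&` (S i `\` \bigcup_n S (sk n))) = 0)) => k.
  by have [mF ?] := Foo k; exact: finite_ess_cover.
have [t tE] := merge_seq _ i0 s.
exists t => i.
have : rho.-negligible (\bigcup_k (F k `&` (S i `\` \bigcup_n S (s k n)))).
  apply: negligible_bigcup => k; apply/negligibleP; last exact: sE.
  apply: measurableI; first by have [] := Foo k.
  by apply: measurableD => //; exact: bigcup_measurable.
move=> neg; rewrite /prop_near1 /nbhs/= /almost_everywhere/=.
apply: negligibleS neg => z /= /not_implyP[Sz nz].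
have [k _ Fz] : (\bigcup_k F k) z by rewrite -FT.
exists k => //; split => //; split => // -[m _ Sm]; apply: nz.
by have [n tn] := tE k m; exists n; rewrite tn.
Qed.

(** * A common factor that is measurable *)

Lemma measurable_fineT d (T : measurableType d) (R : realType) (c : T -> \bar R) :
  measurable_fun setT c -> measurable_fun setT (fine \o c).
Proof. by move=> mc; exact: (measurableT_comp (fine_measurable _)). Qed.

(* Also for [x = +oo]: then [a = 0], and [fine +oo = 0]. *)
Lemma fine_ratio (R : realFieldType) (a : R) (x : \bar R) :
  0 < x -> a%:E * x \is a fin_num ->
  (fine (a%:E * x) * (fine x)^-1)%R = a.
Proof.
case: x => [x||]//=; rewrite ?lte_fin.
  by move=> x0 _; rewrite mulfK ?gt_eqF.
rewrite invr0 mulr0 => _; case: (ltrgt0P a) => [a0|a0|//].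
  by rewrite gt0_muley ?lte_fin.
by rewrite lt0_muley ?lte_fin.
Qed.

(** The factors in the hypothesis are chosen separately for each [z], with no measurability. A
    measurable one is the supremum of the quotients of [q] by [p] along a sequence from [ess_cover]:
    where some [p (s n) z] is positive, this recovers the factor; where none is, [p theta z]
    vanishes almost everywhere and any factor will do. *)
Lemma measurable_common_factor d (T : measurableType d) (R : realType)
    (rho : {sigma_finite_measure set T -> \bar R}) (Theta : Type)
    (p q : Theta -> T -> \bar R) :
  (forall theta, measurable_fun setT (p theta)) -> (forall theta z, 0 <= p theta z) ->
  (forall theta, measurable_fun setT (q theta)) -> (forall theta z, 0 <= q theta z) ->
  (forall theta, \int[rho]_z q theta z < +oo) ->
  {ae rho, forall z, exists w : R, forall theta, q theta z = w%:E * p theta z} ->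
  exists w : T -> R, [/\ measurable_fun setT w, (forall z, (0 <= w z)%R) &
    forall theta, {ae rho, forall z, q theta z = (w z)%:E * p theta z}].
Proof.
move=> mp p0 mq q0 qoo qp.
(* Without any parameter the last clause is vacuous, and the factor 0 serves. *)
have [[theta0]|Theta0] := pselect (inhabited Theta); last first.
  exists (fun=> 0%R); split => // theta; exfalso; exact/Theta0/inhabits.
have [s sE] : exists s : nat -> Theta, forall theta,
    {ae rho, forall z, 0 < p theta z -> exists n, 0 < p (s n) z}.
  apply: (@ess_cover _ _ _ rho _ theta0 (fun theta => [set z | 0 < p theta z])).
  move=> theta; rewrite -[X in measurable X]setTI.
  exact: emeasurable_fun_o_infty.
(* The quotient is 0 where [p] is 0 or infinite, as [fine +oo = 0] and the inverse of 0 is 0. *)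
pose r n z := (fine (q (s n) z) * (fine (p (s n) z))^-1)%R.
have r0 n z : (0 <= r n z)%R by rewrite mulr_ge0// ?invr_ge0 fine_ge0.
have mr n : measurable_fun setT (r n).
  (* On nonnegative reals the inverse is the power with exponent -1, a measurable function. *)
  have rE : r n = (fun z => fine (q (s n) z) * (fine (p (s n) z)) `^ (-1))%R.
    by apply/funext => z; rewrite powR_inv1// fine_ge0.
  rewrite rE; apply: measurable_funM.
    exact: measurable_fineT.
  apply: (measurableT_comp (measurable_powR _)).
  exact: measurable_fineT.
(* From index 0 on, [esups] is the supremum over all [n]. *)
pose w z := esups (fun n => (r n z)%:E) 0%N.
have w0 z : 0 <= w z.
  apply: le_trans (ereal_sup_ubound _); last by exists 0%N.
  by rewrite lee_fin.
exists (fine \o w); split.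
- apply: measurable_fineT.
  apply: (@measurable_fun_esups _ _ _ _ (fun n z => (r n z)%:E)) => n.
  exact/measurable_EFinP.
- by move=> z; exact: fine_ge0.
move=> theta.
(* Finiteness of [q], that is of the product of the factor and [p], is what [fine_ratio] asks
   for. *)
have qfin : {ae rho, forall z, forall n, q (s n) z \is a fin_num}.
  apply/ae_foralln => n.
  have /(integrable_ae measurableT) : rho.-integrable setT (q (s n)).
    apply/integrableP; split => //.
    by under eq_integral do rewrite gee0_abs//.
  by apply: filterS => z; exact.
apply: filterS3 qp qfin (sE theta) => z [a qa] qf sp /=.
have [[n pn]|np] := pselect (exists n, 0 < p (s n) z); last first.
  have pz : p theta z = 0.
    apply/eqP; rewrite eq_le p0 andbT leNgt; apply/negP => /sp; exact: np.
  by rewrite qa pz !mule0.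
have a0 : (0 <= a)%R.
  rewrite leNgt; apply/negP => a0; have := q0 (s n) z.
  by rewrite qa leNgt nmule_rlt0 ?lte_fin// pn.
suff -> : w z = a%:E by [].
(* Each quotient is either 0 or [a], and the value [a] is reached at [n]. *)
apply/eqP; rewrite eq_le; apply/andP; split.
  apply: ge_ereal_sup => _ [m _ <-]; rewrite lee_fin /r.
  have := p0 (s m) z; rewrite le_eqVlt => /orP[/eqP <-|pm].
    by rewrite /= invr0 mulr0.
  by rewrite qa fine_ratio// -qa.
apply: ereal_sup_ubound; exists n => //.
by rewrite /r qa fine_ratio// -qa.
Qed.

(** * The converse implication over an abstract disintegration *)

Section disintegration.
Context d d' (X : measurableType d) (T : measurableType d') (R : realType).
Variables (mu : {measure set X -> \bar R}) (tau : R.-sfker X ~> T).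
Variables (rho : {sigma_finite_measure set T -> \bar R}) (K : R.-sfker T ~> X).
Variables (E : set (X * T)) (Y : set X) (Theta : Type) (f : Theta -> X -> R).
Variable kappa : X * T -> R.
Hypotheses (mE : measurable E) (EY : forall p, E p -> Y p.1).
Hypotheses (mf : forall theta, measurable_fun setT (f theta))
  (f0 : forall theta x, (0 <= f theta x)%R)
  (foo : forall theta, \int[mu]_x (f theta x)%:E < +oo).
Hypothesis complete : forall t : X -> R, measurable_fun setT t ->
  (forall theta, mu.-integrable setT (fun x => (t x * f theta x)%:E)) ->
  (forall theta, \int[mu]_x (t x * f theta x)%:E = 0) ->
  {ae mu, forall x, Y x -> t x = 0%R}.
Hypotheses (mkappa : measurable_fun setT kappa) (kappa0 : forall p, (0 <= kappa p)%R)
  (kappaE : forall p, ~ E p -> kappa p = 0%R)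
  (kappa_le1 : forall x, \int[tau x]_z (kappa (x, z))%:E <= 1).
Hypothesis disintegrate : forall phi : X * T -> \bar R,
  measurable_fun setT phi -> (forall p, 0 <= phi p) ->
  (forall p, ~ E p -> phi p = 0) ->
  \int[mu]_x \int[tau x]_z phi (x, z) = \int[rho]_z \int[K z]_x phi (x, z).

Let disintegrate_mul (g : X * T -> R) theta : measurable_fun setT g ->
  (forall p, (0 <= g p)%R) -> (forall p, ~ E p -> g p = 0%R) ->
  \int[mu]_x ((f theta x)%:E * \int[tau x]_z (g (x, z))%:E) =
  \int[rho]_z \int[K z]_x (f theta x * g (x, z))%:E.
Proof.
move=> mg g0 gE; rewrite -(disintegrate (fun p => (f theta p.1 * g p)%:E)).
- apply: eq_integral => x _; rewrite -ge0_integralZl_EFin//.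
  + by move=> z _; rewrite lee_fin.
  + by apply/measurable_EFinP; exact: measurableT_comp.
- apply/measurable_EFinP; apply: measurable_funM => //.
  exact: measurableT_comp.
- by move=> p; rewrite lee_fin mulr_ge0.
- by move=> p /gE ->; rewrite mulr0.
Qed.

Let measurable_section_integral (g : X * T -> R) theta : measurable_fun setT g ->
  (forall p, (0 <= g p)%R) ->
  measurable_fun setT (fun z => \int[K z]_x (f theta x * g (x, z))%:E).
Proof.
move=> mg g0.
apply: (measurable_fun_integral_sfinite_kernel
  (fun p : T * X => (f theta p.2 * g (p.2, p.1))%:E)).
- by move=> p; rewrite lee_fin mulr_ge0.
- apply/measurable_EFinP; apply: measurable_funM; first exact: measurableT_comp.
  have mswap : measurable_fun setT (fun r : T * X => (r.2, r.1)).
    exact: measurable_swap.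
  exact: (measurableT_comp mg mswap).
Qed.

(** [E] is the relation of membership of a point in an observable set. Since [kappa] vanishes off
    [E], all integrals can run over the whole space; [\1_E] restricts that of [f theta] to the
    section of [E] at [z]. *)
Lemma ae_constant_of_common_factor :
  {ae rho, forall z, exists w : R, forall theta,
    \int[K z]_x (f theta x * kappa (x, z))%:E =
    w%:E * \int[K z]_x (f theta x * \1_E (x, z))%:E} ->
  {ae rho, forall z, exists c : R,
    {ae K z, forall x, E (x, z) -> kappa (x, z) = c}}.
Proof.
move=> factor.
pose q theta z := \int[K z]_x (f theta x * kappa (x, z))%:E.
pose p theta z := \int[K z]_x (f theta x * \1_E (x, z))%:E.
have m1E : measurable_fun setT (\1_E : X * T -> R) by exact: measurable_indic.
have E0 r : (0 <= (\1_E r : R))%R by rewrite indicE.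
have EE r : ~ E r -> \1_E r = 0%R :> R.
  by move=> nE; rewrite indicE memNset.
have mq theta : measurable_fun setT (q theta) by exact: measurable_section_integral.
have mp theta : measurable_fun setT (p theta) by exact: measurable_section_integral.
have q0 theta z : 0 <= q theta z.
  by apply: integral_ge0 => x _; rewrite lee_fin mulr_ge0.
have p0 theta z : 0 <= p theta z.
  by apply: integral_ge0 => x _; rewrite lee_fin mulr_ge0.
have mint (g : X * T -> R) : measurable_fun setT g -> (forall p, (0 <= g p)%R) ->
    measurable_fun setT (fun x => \int[tau x]_z (g (x, z))%:E).
  move=> mg g0; apply: (@measurable_iterated _ _ _ _ _ tau (EFin \o g)).
    exact/measurable_EFinP.
  by move=> r; rewrite lee_fin.
(* The integrals of [kappa] over [z] are at most 1, so [f theta] dominates. This bound feeds both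
   the completeness lemma and the uniqueness of densities. *)
have fkoo theta :
    \int[mu]_x ((f theta x)%:E * \int[tau x]_z (kappa (x, z))%:E) < +oo.
  apply: le_lt_trans (foo theta); apply: ge0_le_integral => //.
  - move=> x _; rewrite mule_ge0 ?lee_fin//.
    by apply: integral_ge0 => z _; rewrite lee_fin.
  - by apply: emeasurable_funM; [exact/measurable_EFinP|exact: mint].
  - exact/measurable_EFinP.
  - by move=> x _; rewrite -[leRHS]mule1 lee_wpmul2l ?lee_fin.
have qoo theta : \int[rho]_z q theta z < +oo.
  by rewrite -(disintegrate_mul kappa theta mkappa kappa0 kappaE).
have [w [mw w0 qpw]] := measurable_common_factor _ _ _ rho _ p q mp p0 mq q0 qoo factor.
(* The factor as a function on pairs, cut off outside [E] so that the integrals can be exchanged for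
   it as for [kappa]. *)
pose omega (r : X * T) : R := (w r.2 * \1_E r)%R.
have momega : measurable_fun setT omega.
  by apply: measurable_funM => //; exact: measurableT_comp.
have omega0 r : (0 <= omega r)%R by rewrite mulr_ge0.
have omegaE r : ~ E r -> omega r = 0%R by move=> /EE nE; rewrite /omega nE mulr0.
have offY (g : X * T -> R) x : (forall r, ~ E r -> g r = 0%R) -> ~ Y x ->
    forall z, g (x, z) = 0%R.
  by move=> gE nYx z; apply: gE => /EY.
have eqB B : measurable B -> {ae mu, forall x,
    \int[tau x]_z (kappa (x, z) * \1_B z)%:E =
    \int[tau x]_z (omega (x, z) * \1_B z)%:E}.
  move=> mB.
  have mgB (g : X * T -> R) : measurable_fun setT g ->
      measurable_fun setT (fun r => g r * \1_B r.2)%R.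
    by move=> mg; apply: measurable_funM => //; exact: measurableT_comp.
  have gB0 (g : X * T -> R) : (forall r, (0 <= g r)%R) -> forall r,
      (0 <= g r * \1_B r.2)%R.
    by move=> g0 r; rewrite mulr_ge0// indicE.
  have gBE (g : X * T -> R) : (forall r, ~ E r -> g r = 0%R) ->
      forall r, ~ E r -> (g r * \1_B r.2)%R = 0%R.
    by move=> gE r /gE ->; rewrite mul0r.
  have ae_eqB : {ae mu, forall x, Y x ->
    \int[tau x]_z (kappa (x, z) * \1_B z)%:E =
    \int[tau x]_z (omega (x, z) * \1_B z)%:E}.
    apply: (complete_ae_eq _ _ _ mu _ _ f mf f0 complete).
    - exact: (mint _ (mgB _ mkappa) (gB0 _ kappa0)).
    - move=> x; apply: integral_ge0 => z _.
      by rewrite lee_fin; exact: (gB0 _ kappa0 (x, z)).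
    - exact: (mint _ (mgB _ momega) (gB0 _ omega0)).
    - move=> x; apply: integral_ge0 => z _.
      by rewrite lee_fin; exact: (gB0 _ omega0 (x, z)).
    - move=> theta; apply: le_lt_trans (fkoo theta); apply: ge0_le_integral => //.
      + move=> x _; rewrite mule_ge0 ?lee_fin//.
        by apply: integral_ge0 => z _; rewrite lee_fin; exact: (gB0 _ kappa0 (x, z)).
      + apply: emeasurable_funM; first exact/measurable_EFinP.
        exact: (mint _ (mgB _ mkappa) (gB0 _ kappa0)).
      + by apply: emeasurable_funM; [exact/measurable_EFinP|exact: mint].
      + move=> x _; apply: lee_wpmul2l; first by rewrite lee_fin.
        apply: ge0_le_integral => //.
        * by move=> z _; rewrite lee_fin; exact: (gB0 _ kappa0 (x, z)).
        * have /measurable_EFinP mk := mgB _ mkappa.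
          exact: (measurableT_comp mk).
        * by apply/measurable_EFinP; exact: measurableT_comp.
        * by move=> z _; rewrite lee_fin ler_piMr// indicE; case: (_ \in _).
    - move=> theta.
      (* After the exchange, [\1_B z] and [w z] are constants for the inner integral, and [qpw]
         applies for almost every [z]. *)
      rewrite (disintegrate_mul _ theta (mgB _ mkappa) (gB0 _ kappa0) (gBE _ kappaE)).
      rewrite (disintegrate_mul _ theta (mgB _ momega) (gB0 _ omega0) (gBE _ omegaE)).
      have scale (g : X * T -> R) (c : T -> R) : measurable_fun setT g ->
          (forall r, (0 <= g r)%R) -> (forall z, (0 <= c z)%R) ->
          forall z, \int[K z]_x (f theta x * (c z * g (x, z)))%:E =
                    (c z)%:E * \int[K z]_x (f theta x * g (x, z))%:E.
        move=> mg g0 c0 z; rewrite -ge0_integralZl_EFin//.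
        - by apply: eq_integral => x _; rewrite -EFinM mulrCA.
        - by move=> x _; rewrite lee_fin mulr_ge0.
        - apply/measurable_EFinP; apply: measurable_funM => //.
          exact: measurableT_comp.
      have B0 z : (0 <= (\1_B z : R))%R by rewrite indicE.
      have mB1 : measurable_fun setT (\1_B : T -> R) by exact: measurable_indic.
      transitivity (\int[rho]_z ((\1_B z)%:E * q theta z)).
        apply: eq_integral => z _; rewrite -(scale kappa \1_B)//.
        by apply: eq_integral => x _; rewrite [(\1_B z * _)%R]mulrC.
      transitivity (\int[rho]_z ((\1_B z * w z)%:E * p theta z)); last first.
        apply: eq_integral => z _.
        rewrite -(scale \1_E (fun z => \1_B z * w z)%R)//; last first.
          by move=> ?; rewrite mulr_ge0.
        apply: eq_integral => x _; congr (_ * _)%:E.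
        by rewrite /omega/= [RHS]mulrC mulrA.
      apply: ae_eq_integral => //.
      + by apply: emeasurable_funM => //; exact/measurable_EFinP.
      + apply: emeasurable_funM => //; apply/measurable_EFinP.
        exact: measurable_funM.
      + by apply: filterS (qpw theta) => z qz _; rewrite qz muleA EFinM.
  (* Completeness says nothing off [Y], but there both integrands vanish. *)
  apply: filterS ae_eqB => x abx; have [/abx//|nYx] := pselect (Y x).
  by apply: eq_integral => z _; rewrite (offY kappa)// (offY omega).
pose dist (r : X * T) : R := `|kappa r - omega r|%R.
have mdist : measurable_fun setT dist.
  by apply: measurableT_comp => //; exact: measurable_funB.
have dist0 r : (0 <= dist r)%R by exact: normr_ge0.
have distE r : ~ E r -> dist r = 0%R.
  by move=> nE; rewrite /dist kappaE// omegaE// subr0 normr0.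
(* The weight [f theta x] gives the finite mass required by [iterated_integral_dist_eq0], and it
   preserves the equalities [eqB]. *)
have fdist0 theta : \int[mu]_x ((f theta x)%:E * \int[tau x]_z (dist (x, z))%:E) = 0.
  have mfg (g : X * T -> R) : measurable_fun setT g ->
      measurable_fun setT (fun r => f theta r.1 * g r)%R.
    by move=> mg; apply: measurable_funM => //; exact: measurableT_comp.
  have fg0 (g : X * T -> R) : (forall r, (0 <= g r)%R) -> forall r,
      (0 <= f theta r.1 * g r)%R.
    by move=> g0 r; rewrite mulr_ge0.
  have pull (g : X * T -> R) x : measurable_fun setT g -> (forall r, (0 <= g r)%R) ->
      \int[tau x]_z (f theta x * g (x, z))%:E =
      (f theta x)%:E * \int[tau x]_z (g (x, z))%:E.
    move=> mg g0; rewrite -ge0_integralZl_EFin//.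
    - by move=> z _; rewrite lee_fin.
    - by apply/measurable_EFinP; exact: measurableT_comp.
  rewrite -(@iterated_integral_dist_eq0 _ _ X T R mu tau _ _ (mfg _ mkappa)
    (mfg _ momega) (fg0 _ kappa0) (fg0 _ omega0)).
  - apply: eq_integral => x _; rewrite -pull//; apply: eq_integral => z _.
    by rewrite -mulrBr normrM ger0_norm.
  - by under eq_integral do rewrite pull//; exact: fkoo.
  - move=> B mB; apply: filterS (eqB _ mB) => x abx /=.
    have pullB (g : X * T -> R) : measurable_fun setT g -> (forall r, (0 <= g r)%R) ->
        \int[tau x]_z (f theta x * g (x, z) * \1_B z)%:E =
        (f theta x)%:E * \int[tau x]_z (g (x, z) * \1_B z)%:E.
      move=> mg g0; rewrite -(pull (fun r => g r * \1_B r.2)%R).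
      - by apply: eq_integral => z _; rewrite mulrA.
      - by apply: measurable_funM => //; exact: measurableT_comp.
      - by move=> r; rewrite mulr_ge0// indicE.
    by rewrite pullB// pullB// abx.
(* As [fdist0] holds for every [theta], completeness compares the unweighted distance with 0. *)
have aedist : {ae mu, forall x, Y x -> \int[tau x]_z (dist (x, z))%:E = 0}.
  apply: (complete_ae_eq _ _ _ mu _ _ f mf f0 complete _ (cst 0)) => //.
  - exact: mint.
  - by move=> x; apply: integral_ge0 => z _; rewrite lee_fin.
  - by move=> theta; rewrite fdist0.
  - move=> theta; rewrite fdist0.
    by under eq_integral do rewrite mule0; rewrite integral0.
have : \int[rho]_z \int[K z]_x (dist (x, z))%:E = 0.
  rewrite -(disintegrate (EFin \o dist)).
  - rewrite -(integral0 mu setT); apply: ae_eq_integral => //.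
      exact: mint.
    apply: filterS aedist => x dx _; have [/dx//|nYx] := pselect (Y x).
    by apply: integral0_eq => z _ /=; rewrite (offY dist).
  - exact/measurable_EFinP.
  - by move=> r; rewrite lee_fin.
  - by move=> r /distE/= ->.
have mdistK : measurable_fun setT (fun z => \int[K z]_x (dist (x, z))%:E).
  apply: (measurable_fun_integral_sfinite_kernel
    (fun r : T * X => (dist (r.2, r.1))%:E)).
  - by move=> r; rewrite lee_fin.
  - apply/measurable_EFinP.
    have mswap : measurable_fun setT (fun r : T * X => (r.2, r.1)).
      exact: measurable_swap.
    exact: (measurableT_comp mdist mswap).
have distK0 z : 0 <= \int[K z]_x (dist (x, z))%:E.
  by apply: integral_ge0 => x _; rewrite lee_fin.
(* A nonnegative function with integral 0 vanishes almost everywhere: this is used for [rho] and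
   then for [K z]. *)
move=> /(ae_eq0_integral _ _ _ _ _ mdistK distK0); apply: filterS => z dz.
exists (w z).
have mdz : measurable_fun setT (fun x => (dist (x, z))%:E).
  by apply/measurable_EFinP; exact: measurableT_comp.
have dz0 x : 0 <= (dist (x, z))%:E by rewrite lee_fin.
apply: filterS (ae_eq0_integral _ _ _ _ _ mdz dz0 dz) => x [] /eqP.
rewrite normr_eq0 subr_eq0 => /eqP -> Exz.
by rewrite /omega indicE mem_set// mulr1.
Qed.
End disintegration.

(** * Transfer to coarse data *)

Lemma integral_supported d (X : measurableType d) (R : realType)
    (mu : {measure set X -> \bar R}) (D : set X) (g : X -> \bar R) :
  (forall x, ~ D x -> g x = 0) -> \int[mu]_(x in D) g x = \int[mu]_x g x.
Proof.
move=> gD; rewrite integral_mkcond; apply: eq_integral => x _.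
rewrite patchE; case: ifPn => // /negP xD; rewrite gD// => Dx.
by apply: xD; exact/mem_set.
Qed.

Lemma measurable_fun_patch0 d (X : measurableType d) (R : realType) (D : set X)
    (g : X -> R) : measurable D -> measurable_fun D g ->
  measurable_fun setT (patch (fun=> 0%R) D g).
Proof. by move=> mD mg; exact: (measurable_restrictT g mD).1. Qed.

Lemma ae_eq_measure d (X : measurableType d) (R : realType)
    (mu nu : {measure set X -> \bar R}) (P : X -> Prop) :
  (forall A, measurable A -> mu A = nu A) ->
  {ae mu, forall x, P x} -> {ae nu, forall x, P x}.
Proof. by move=> munu [N [mN N0 NP]]; exists N; split => //; rewrite -munu. Qed.

Section coarse_data.
Context (R : realType) (k : nat) (dZ : measure_display)
    (TZ : measurableType dZ) (Theta : Type)
    (Y : set (realvec R k)) (f : realvec R k -> Theta -> R)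
    (elts : TZ -> set (realvec R k))
    (tau : R.-sfker realvec R k ~> TZ)
    (rho : {sigma_finite_measure set TZ -> \bar R})
    (kappa : TZ -> realvec R k -> R).
Hypotheses (mY : measurable Y)
  (density_f : forall theta, density_on (lebesgue_tuple R k) Y (f^~ theta)).
Let E := [set p : realvec R k * TZ | elts p.2 p.1].
Hypotheses (mE : measurable E) (eltsY : forall z, elts z `<=` Y).
Hypothesis reference : compatible_reference Y elts tau rho.
Hypotheses (mkappa : measurable_fun E (fun p => kappa p.2 p.1))
  (kappa0 : forall z y, elts z y -> (0 <= kappa z y)%R)
  (kappa1 : forall y, Y y ->
     \int[tau y]_(z in [set z | elts z y]) (kappa z y)%:E = 1).

Let measurable_elts z : measurable (elts z).
Proof.
have := measurable_ysection z mE; congr measurable.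
by apply/seteqP; split => y; rewrite /ysection/= inE.
Qed.

Lemma constant_of_proportional : complete_family Y f ->
  {ae rho, forall z, exists w : R, forall theta,
    \int[free_lebesgue (elts z)]_(y in elts z) (f y theta * kappa z y)%:E =
    w%:E * \int[free_lebesgue (elts z)]_(y in elts z) (f y theta)%:E} ->
  {ae rho, forall z, exists c : R,
    {ae free_lebesgue (elts z), forall y, elts z y -> kappa z y = c}}.
Proof.
move=> complete_f lig; have [[K KE] ref] := reference.
(* [kappa] is extended by 0 off [E], and each density by 0 off [Y], to fit the abstract setting. *)
pose kap : realvec R k * TZ -> R := 
  patch (fun=> 0%R) E (fun p => kappa p.2 p.1).
pose ff theta : realvec R k -> R := patch (fun=> 0%R) Y (f^~ theta).
have kapE z y : elts z y -> kap (y, z) = kappa z y.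
  by move=> zy; rewrite /kap patchE mem_set.
have kapN p : ~ E p -> kap p = 0%R by move=> nE; rewrite /kap patchE memNset.
have ffE theta y : Y y -> ff theta y = f y theta.
  by move=> Yy; rewrite /ff patchE mem_set.
have ffN theta y : ~ Y y -> ff theta y = 0%R.
  by move=> nY; rewrite /ff patchE memNset.
have mkap : measurable_fun setT kap by exact: measurable_fun_patch0.
have mff theta : measurable_fun setT (ff theta).
  by apply: measurable_fun_patch0 => //; have [] := density_f theta.
have kap0 p : (0 <= kap p)%R.
  by rewrite /kap patchE; case: ifPn => // /set_mem; exact: kappa0.
have ff0 theta y : (0 <= ff theta y)%R.
  rewrite /ff patchE; case: ifPn => // /set_mem Yy.
  by have [_ + _] := density_f theta; apply.
have ffoo theta : \int[lebesgue_tuple R k]_y (ff theta y)%:E < +oo.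
  rewrite -(@integral_supported _ _ _ _ Y); last by move=> y /ffN ->.
  have [_ _] := density_f theta; rewrite (eq_integral (fun y => (ff theta y)%:E)).
    by move=> ->; exact: ltry.
  by move=> y /set_mem Yy; rewrite ffE.
(* [K z] agrees with [free_lebesgue (elts z)] on measurable sets; being a kernel, it also gives
   measurability in [z]. *)
have intK z g : \int[free_lebesgue (elts z)]_(y in elts z) g y =
                \int[K z]_(y in elts z) g y.
  by apply: eq_measure_integral => A mA _; rewrite KE.
have : {ae rho, forall z, exists c : R,
    {ae K z, forall x, E (x, z) -> kap (x, z) = c}}.
  apply: (@ae_constant_of_common_factor _ _ _ _ R (lebesgue_tuple R k) tau rho K
    E Y Theta ff kap mE _ mff ff0 ffoo _ mkap kap0 kapN).
  - by move=> [y z] /= /eltsY.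
  - move=> t mt tint t0.
    have tE theta y : (t y * ff theta y)%:E =
        ((fun y => (t y * f y theta)%:E) \_ Y) y.
      rewrite /ff !patchE; by case: ifPn => //; rewrite mulr0.
    apply: complete_f.
    + exact: measurable_funTS.
    + move=> theta; apply/integrable_mkcond => //.
      rewrite -(_ : (fun y => (t y * ff theta y)%:E) =
        (fun y => (t y * f y theta)%:E) \_ Y)//.
      by apply/funext.
    + move=> theta; rewrite integral_mkcond -(t0 theta).
      by apply: eq_integral => y _; rewrite tE.
  (* The mass is 1 for [y] in [Y]; otherwise no [elts z] contains [y] and it is 0. *)
  - move=> y; have [Yy|nY] := pselect (Y y); last first.
      rewrite integral0_eq// => z _.
      by rewrite kapN// => /= /eltsY.
    rewrite -(@integral_supported _ _ _ _ [set z | elts z y]); last first.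
      by move=> z nz; rewrite kapN.
    rewrite -(kappa1 _ Yy) (eq_integral (fun z => (kappa z y)%:E))//.
    by move=> z /set_mem zy; rewrite kapE.
  - move=> phi mphi phi0 phiE.
    transitivity (\int[lebesgue_tuple R k]_(y in Y)
        \int[tau y]_(z in [set z | elts z y]) phi (y, z)).
      rewrite -(@integral_supported _ _ _ _ Y).
        apply: eq_integral => y _.
        rewrite (@integral_supported _ _ _ _ [set z | elts z y])// => z nz.
        exact: phiE.
      move=> y nY; rewrite integral0_eq// => z _.
      by rewrite phiE// => /= /eltsY.
    rewrite ref//; apply: eq_integral => z _.
    rewrite intK integral_supported// => y ny.
    by rewrite phiE.
  - apply: filterS lig => z [w wE]; exists w => theta.
    have := wE theta; rewrite !intK => e.
    transitivity (\int[K z]_(y in elts z) (f y theta * kappa z y)%:E).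
      rewrite -(@integral_supported _ _ _ _ (elts z)).
        by apply: eq_integral => y /set_mem zy; rewrite kapE// ffE//; exact: eltsY zy.
      by move=> y nzy; rewrite kapN// mulr0.
    rewrite e -[in RHS](@integral_supported _ _ _ _ (elts z)).
      congr (_ * _); apply: eq_integral => y /set_mem zy.
      by rewrite indicE mem_set// mulr1 ffE//; exact: eltsY zy.
    by move=> y nzy; rewrite indicE memNset// mulr0.
apply: filterS => z [c cz]; exists c.
apply: (@ae_eq_measure _ _ _ (K z)) => [A mA|]; first by rewrite KE.
by apply: filterS cz => y yc zy; rewrite -(kapE z y zy) yc.
Qed.

(** The factor is the absolute value because [c] is arbitrary, possibly negative, when [elts z] is
    null; both integrals are then 0. Otherwise [c] is a value of [kappa], hence nonnegative. *)
Lemma proportional_of_constant z (c : R) :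
  {ae free_lebesgue (elts z), forall y, elts z y -> kappa z y = c} ->
  forall theta,
    \int[free_lebesgue (elts z)]_(y in elts z) (f y theta * kappa z y)%:E =
    `|c|%:E * \int[free_lebesgue (elts z)]_(y in elts z) (f y theta)%:E.
Proof.
move=> cz theta; have [mf f0 _] := density_f theta.
have mfz : measurable_fun (elts z) (f^~ theta).
  by apply: measurable_funS mf => //; exact: eltsY.
rewrite -ge0_integralZl_EFin//; last 2 first.
- by move=> y /eltsY/f0; rewrite lee_fin.
- exact/measurable_EFinP.
apply: ae_eq_integral => //.
- apply/measurable_EFinP; apply: measurable_funM => //.
  (* The section of [kappa] at [z] is its composite with the map from [y] to [(y, z)], which sends
     [elts z] into [E]. *)
  have sub : (fun y => (y, z)) @` elts z `<=` E by move=> _ [y zy <-].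
  apply: (measurable_comp mE sub mkappa).
  exact: measurable_funTS.
- by apply/measurable_EFinP; exact: measurable_funM.
apply: filterS cz => y yc zy; rewrite /= mulrC EFinM (yc zy).
by rewrite ger0_norm// -(yc zy) kappa0.
Qed.

End coarse_data.

(** * Equivalence of the two conditions *)

Theorem theorem4p1 (R : realType) (k : nat) (dG dZ : measure_display)
    (TG : measurableType dG) (TZ : measurableType dZ) (Theta Psi : Type)
    (Y : set (realvec R k)) (f : realvec R k -> Theta -> R)
    (dg : {sigma_finite_measure set TG -> \bar R})
    (h : TG -> realvec R k -> Psi -> R)
    (elts : TZ -> set (realvec R k)) (Z : realvec R k -> TG -> TZ)
    (tau : R.-sfker realvec R k ~> TZ)
    (rho : {sigma_finite_measure set TZ -> \bar R})
    (kappa : TZ -> realvec R k -> Psi -> R)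
    (measurable_Y : measurable Y)
    (density_f : forall theta, density_on (lebesgue_tuple R k) Y (f^~ theta))
    (cdm_h : forall psi, is_cdm Y dg (fun g y => h g y psi))
    (coarsening_Z : is_coarsening Y elts Z)
    (reference : compatible_reference Y elts tau rho)
    (density_kappa : forall psi,
      is_coarsening_density Y dg elts Z tau
        (fun g y => h g y psi) (fun z y => kappa z y psi))
    (complete_f : complete_family Y f) :
  LIG elts rho f kappa <-> CAR elts rho kappa.
Proof.
have [_ eltsY mE _ _] := coarsening_Z.
split=> [lig|car] psi; have [mkappa kappa0 kappaE] := density_kappa psi.
- apply: (constant_of_proportional R k dZ TZ Theta Y f elts tau rho _
    measurable_Y density_f mE eltsY reference mkappa kappa0 _ complete_f (lig psi)).
  (* Taking all of [TZ] for [B], [kappa] has the same total mass as the density [h], namely 1. *)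
  move=> y Yy; have [_ h1] := cdm_h psi; have [_ _ <-] := h1 y Yy.
  by have := kappaE y Yy _ measurableT; rewrite setTI => <-.
- apply: filterS (car psi) => z [c cz]; exists `|c|%R.
  exact: (proportional_of_constant R k dZ TZ Theta Y f elts _
    measurable_Y density_f mE eltsY mkappa kappa0 z c cz).
Qed.
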